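(* Let $P$ be an ergodic transition matrix on $D$, reversible with respect to $\pi$, let $\nu$ be a probability distribution on $D$, and let $X_1,\dots,X_{n+n_0}$ be the Markov chain with transition matrix $P$ and initial distribution $\nu$ (with integers $n\ge 1$, $n_0\ge 0$). Let $f\in\mathbb{R}^D$ and $a_k=\langle f,u_k\rangle_\pi$. Then, for every fixed $n_0$, $$\lim_{n\to\infty} n\cdot e_\nu(S_{n,n_0},f)^2=\lim_{n\to\infty} n\cdot e_\pi(S_n,f)^2=\sum_{k=1}^{|D|-1}|a_k|^2\,\frac{1+\beta_k}{1-\beta_k}.$$ Moreover, for all $n\ge1$ and $n_0\ge 0$: (i) (with respect to the $\ell_2$-norm) $$e_\nu(S_{n,n_0},f)^2\le \frac{2}{n(1-\beta_1)}\|f\|_2^2+\frac{2\sqrt{\left\|\frac1\pi\right\|_\infty}\sqrt{\left\|\frac{\nu}{\pi}-1\right\|_\infty}\,\beta^{n_0}}{n^2(1-\beta)^2}\|f\|_2^2 ;$$ (ii) (with respect to the $\ell_4$-norm) $$e_\nu(S_{n,n_0},f)^2\le \frac{2}{n(1-\beta_1)}\|f\|_4^2+\frac{16\sqrt2\,\sqrt{\left\|\frac{\nu}{\pi}-1\right\|_\infty}\,\beta^{n_0}}{n^2(1-\beta)(1-\sqrt{\beta})}\|f\|_4^2 ;$$ (iii) (with respect to the $\ell_\infty$-norm) $$e_\nu(S_{n,n_0},f)^2\le \frac{2}{n(1-\beta_1)}\|f\|_\infty^2+\frac{4\sqrt{\left\|\frac{\nu}{\pi}-1\right\|_\infty}\,\beta^{n_0}}{n^2(1-\beta)^2}\|f\|_\infty^2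 .$$
   Context: $D$ is a finite set with $|D|\ge2$, $\pi$ is a probability distribution on $D$, and $P=(p(x,y))_{x,y\in D}$ is a (row-stochastic) transition matrix. $P$ is reversible with respect to $\pi$ if $\pi(x)p(x,y)=\pi(y)p(y,x)$ for all $x,y\in D$. $P$ is ergodic if it is irreducible and aperiodic; then $\pi$ is the unique stationary distribution and $\pi(x)>0$ for all $x$. Put $\langle f,g\rangle_\pi=\sum_{x\in D}f(x)g(x)\pi(x)$, $\|f\|_p^p=\sum_{x\in D}|f(x)|^p\pi(x)$ for $1\le p<\infty$, $\|f\|_\infty=\max_{x\in D}|f(x)|$, and $S(f)=\sum_{x\in D}f(x)\pi(x)$. Here $\frac1\pi$ and $\frac\nu\pi-1$ denote the functions $x\mapsto 1/\pi(x)$ and $x\mapsto \nu(x)/\pi(x)-1$. $P$, acting by $Pf(x)=\sum_{y}p(x,y)f(y)$, is self-adjoint for $\langle\cdot,\cdot\rangle_\pi$ and has real eigenvalues $1=\beta_0>\beta_1\ge\beta_2\ge\dots\ge\beta_{|D|-1}>-1$ with an orthonormal basis of eigenfunctions $u_0=\mathbf 1,u_1,\dots,u_{|D|-1}$, $Pu_i=\beta_iu_i$, $\langle u_i,u_j\rangle_\pi=\delta_{ij}$. Put $\beta=\max\{\beta_1,|\beta_{|D|-1}|\}<1$ (with $0^0=1$). The Markov chain with initial distribution $\nu$ and transition matrix $P$ has law $\nu(x_1)p(x_1,x_2)\cdots p(x_{n+n_0-1},x_{n+n_0})$ on $D^{n+n_0}$; $\mathbf{E}_{\nu,P}$ denotes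 expectation under this law. Define $S_{n,n_0}(f)=\frac1n\sum_{i=1}^nf(X_{i+n_0})$, $S_n=S_{n,0}$, and $e_\nu(S_{n,n_0},f)=\left(\mathbf{E}_{\nu,P}|S_{n,n_0}(f)-S(f)|^2\right)^{1/2}$; $e_\pi(S_n,f)$ is the same quantity with initial distribution $\pi$ and $n_0=0$. *)

(* Defs.v *)
From HB Require Import structures.
From mathcomp Require Import all_boot all_order all_algebra.
From mathcomp Require Import classical_sets reals topology normedtype sequences.
From mathcomp Require Import exp.

Set Implicit Arguments.
Unset Strict Implicit.
Unset Printing Implicit Defensive.

Import Order.TTheory GRing.Theory Num.Theory.
Import numFieldNormedType.Exports.
Local Open Scope ring_scope.

Definition distribution (R : realType) (D : finType) (pi : D -> R) : Prop :=
  (forall x, 0 <= pi x) /\ \sum_(x : D) pi x = 1.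

Definition stochastic (R : realType) (D : finType) (p : D -> D -> R) : Prop :=
  forall x, distribution (p x).

Definition reversible (R : realType) (D : finType) (pi : D -> R)
    (p : D -> D -> R) : Prop :=
  forall x y, pi x * p x y = pi y * p y x.

Fixpoint transition_pow (R : realType) (D : finType) (p : D -> D -> R)
    (n : nat) (x y : D) : R :=
  if n is m.+1 then \sum_(z : D) p x z * transition_pow p m z y
  else (x == y)%:R.

Definition irreducible (R : realType) (D : finType) (p : D -> D -> R) : Prop :=
  forall x y, exists2 n : nat, (0 < n)%N & 0 < transition_pow p n x y.

(* The gcd of the return times {n >= 1 | p^n(x,x) > 0} is 1, expressed through
   common divisors because this set is infinite. *)
Definition aperiodic (R : realType) (D : finType) (p : D -> D -> R) : Prop :=
  forall (x : D) (d : nat),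
    (forall n : nat, (0 < n)%N -> 0 < transition_pow p n x x -> (d %| n)%N) ->
    d = 1%N.

Definition ergodic (R : realType) (D : finType) (p : D -> D -> R) : Prop :=
  irreducible p /\ aperiodic p.

Definition inner (R : realType) (D : finType) (pi f g : D -> R) : R :=
  \sum_(x : D) f x * g x * pi x.

Definition lpnorm (R : realType) (D : finType) (pi : D -> R) (q : R)
    (f : D -> R) : R :=
  (\sum_(x : D) (`|f x| `^ q) * pi x) `^ q^-1.

Definition linfnorm (R : realType) (D : finType) (f : D -> R) : R :=
  \big[Num.max/0]_(x : D) `|f x|.

Definition mean (R : realType) (D : finType) (pi f : D -> R) : R :=
  \sum_(x : D) f x * pi x.

Definition markov_op (R : realType) (D : finType) (p : D -> D -> R)
    (f : D -> R) (x : D) : R :=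
  \sum_(y : D) p x y * f y.

(* Only the indices i < #|D| matter; [beta] and [u] are arbitrary beyond.
   An orthonormal family of #|D| functions is automatically a basis. *)
Definition spectral_basis (R : realType) (D : finType) (pi : D -> R)
    (p : D -> D -> R) (beta : nat -> R) (u : nat -> D -> R) : Prop :=
  [/\ forall x, u 0%N x = 1,
      forall i x, (i < #|D|)%N -> markov_op p (u i) x = beta i * u i x,
      forall i j, (i < #|D|)%N -> (j < #|D|)%N ->
        inner pi (u i) (u j) = (i == j)%:R
    & forall i j, (i <= j)%N -> (j < #|D|)%N -> beta j <= beta i].

Definition beta_abs (R : realType) (D : finType) (beta : nat -> R) : R :=
  Num.max (beta 1%N) `|beta #|D|.-1|.

Fixpoint path_mass (R : realType) (D : finType) (p : D -> D -> R)
    (x : D) (s : seq D) : R :=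
  if s is y :: s' then p x y * path_mass p y s' else 1.

(* The law nu(x_1) p(x_1,x_2) ... p(x_{N-1},x_N) of the first N states. *)
Definition chain_mass (R : realType) (D : finType) (nu : D -> R)
    (p : D -> D -> R) (s : seq D) : R :=
  if s is x :: s' then nu x * path_mass p x s' else 1.

Definition chain_expect (R : realType) (D : finType) (nu : D -> R)
    (p : D -> D -> R) (N : nat) (g : N.-tuple D -> R) : R :=
  \sum_(w : N.-tuple D) g w * chain_mass nu p w.

(* With 0-based positions, X_{i+n0} for 1 <= i <= n is the component of [w] at
   n0 + i for 0 <= i < n. *)
Definition sample_mean (R : realType) (D : finType) (n n0 : nat) (f : D -> R)
    (w : (n0 + n).-tuple D) : R :=
  n%:R^-1 * \sum_(i < n) f (tnth w (rshift n0 i)).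

Definition error (R : realType) (D : finType) (pi nu : D -> R)
    (p : D -> D -> R) (n n0 : nat) (f : D -> R) : R :=
  Num.sqrt (chain_expect nu p
    (fun w : (n0 + n).-tuple D => `|sample_mean f w - mean pi f| ^+ 2)).

(* Main.v *)
(** With g = f - S(f), d = nu/pi - 1 and times counted from 0, reversibility gives
      E_nu[g(X_i) g(X_j)] = <g, P^|i-j| g> + <P^min(i,j) (g P^|i-j| g), d>.
    The first term does not depend on nu; expanded in the eigenbasis it is the
    stationary error, which is a combination of the sums of beta_k^|i-j| over
    i, j.  The second is at most b^min(i,j) |d|_2 |g P^|i-j| g|_2, where
    |d|_2^2 = sum nu d <= |d|_oo, and the three bounds come from three estimates
    of |g P^k g|_2.  For the l_4 bound, P^k - S has norm b^k on l_2 and 2 on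
    l_oo; instead of Riesz-Thorin, a dyadic layer-cake argument yields norm at
    most 1024^(1/4) b^(k/2) on l_4, which is exactly what the constant
    16 sqrt 2 allows. *)

Require Import Defs.
From HB Require Import structures.
From mathcomp Require Import all_boot all_order all_algebra.
From mathcomp Require Import classical_sets reals topology normedtype sequences.
From mathcomp Require Import exp.
From mathcomp Require Import ring lra.

Set Implicit Arguments.
Unset Strict Implicit.
Unset Printing Implicit Defensive.

Import Order.TTheory GRing.Theory Num.Theory.
Import numFieldNormedType.Exports.
Local Open Scope classical_set_scope.
Local Open Scope ring_scope.

(** * Sums of powers with exponents |i - j| and min(i, j) *)

Section GeometricSums.
Variable R : realFieldType.
Implicit Types (b c : R) (n : nat).


Lemma geometric_sum c n : (1 - c) * (\sum_(i < n) c ^+ i) = 1 - c ^+ n.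
Proof. by rewrite -[LHS]opprK -mulNr opprB -subrX1 opprB. Qed.

Lemma geometric_sum_le c n : 0 <= c < 1 -> \sum_(i < n) c ^+ i <= (1 - c)^-1.
Proof.
move=> /andP[c0 c1]; have c1' : 0 < 1 - c by lra.
rewrite -[leRHS]mul1r ler_pdivlMr // mulrC geometric_sum.
by rewrite gerBl exprn_ge0.
Qed.

(** The distance |i - j|: subtraction is truncated, so at least one of the two summands is zero. *)
Definition natdist i j : nat := ((i - j) + (j - i))%N.

Lemma natdistC i j : natdist i j = natdist j i.
Proof. by rewrite /natdist addnC. Qed.

(** Going from n to n + 1 adds a diagonal 1 and twice the tail b + ... + b^n, itself geometric. The
    factor 1 - b stays on the left so that no condition on b is needed. *)
Lemma dist_power_sum b n :
  (1 - b) * (\sum_(i < n) \sum_(j < n) b ^+ natdist i j) =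
  n%:R * (1 + b) - 2 * b * \sum_(i < n) b ^+ i.
Proof.
have tail m : (1 - b) * (\sum_(i < m) b ^+ (m - i)) = b - b ^+ m.+1.
  elim: m => [|m IH]; first by rewrite big_ord0 expr1 mulr0 subrr.
  rewrite big_ord_recr /= subSnn expr1.
  under eq_bigr => i _ do rewrite subSn ?exprS 1?ltnW //.
  by rewrite -mulr_sumr mulrDr mulrCA IH !exprS; ring.
elim: n => [|n IH]; first by rewrite !big_ord0 !mulr0 mul0r subr0.
rewrite big_ord_recr /=.
under eq_bigr => i _ do rewrite big_ord_recr /=.
rewrite big_split /= [X in _ + _ + X]big_ord_recr /= {4}/natdist subnn expr0.
have E : \sum_(i < n) b ^+ natdist i n = \sum_(i < n) b ^+ (n - i).
  apply: eq_bigr => i _; congr (_ ^+ _); rewrite /natdist.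
  by move: (ltnW (ltn_ord i)); rewrite -subn_eq0 => /eqP ->.
have -> : \sum_(i < n) b ^+ natdist n i = \sum_(i < n) b ^+ natdist i n.
  by apply: eq_bigr => i _; rewrite natdistC.
rewrite E !mulrDr IH tail big_ord_recr /= mulr1 exprS -natr1; ring.
Qed.

(** The exact formula reduces this to -2b sum b^i <= n(1 - b). The left side is at most 0 if b >= 0,
    and at most -2bn <= n(1 - b) if -1 <= b < 0. Eigenvalues near -1 thus cost nothing, so beta_1
    alone controls the stationary error. *)
Lemma dist_power_sum_le b c n : -1 <= b -> b <= c -> c < 1 ->
  \sum_(i < n) \sum_(j < n) b ^+ natdist i j <= 2 * n%:R / (1 - c).
Proof.
move=> b1 bc c1; have c1' : 0 < 1 - c by lra.
have b1' : 0 < 1 - b by lra.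
apply: (@le_trans _ _ (2 * n%:R / (1 - b))); last first.
  by rewrite ler_wpM2l ?mulr_ge0 // lef_pV2 ?posrE //; lra.
rewrite ler_pdivlMr // mulrC dist_power_sum.
suff : - (2 * b * \sum_(i < n) b ^+ i) <= n%:R * (1 - b) by lra.
have sumn : `|\sum_(i < n) b ^+ i| <= n%:R.
  apply: le_trans (ler_norm_sum _ _ _) _.
  rewrite -[X in _ <= X%:R](card_ord n) -sumr_const; apply: ler_sum => i _.
  by rewrite normrX exprn_ile1 // ler_norml; lra.
have n0 : 0 <= n%:R :> R by [].
have [b0|b0] := leP 0 b.
  have : 0 <= \sum_(i < n) b ^+ i by apply: sumr_ge0 => i _; exact: exprn_ge0.
  by nra.
by move: sumn; rewrite ler_norml => /andP[_ sumn]; nra.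
Qed.

(** The exact formula leaves the remainder -2b(1 - b^n)/(1 - b)^2, bounded uniformly in n. *)
Lemma dist_power_sum_asymptotics b n : `|b| < 1 ->
  `|\sum_(i < n) \sum_(j < n) b ^+ natdist i j - n%:R * ((1 + b) / (1 - b))| <=
  4 / (1 - b) ^+ 2.
Proof.
move=> b1; have b1' : 0 < 1 - b by move: b1; rewrite ltr_norml => /andP[_]; lra.
have Wn := dist_power_sum b n.
have Sn : \sum_(i < n) b ^+ i = (1 - b ^+ n) / (1 - b).
  by rewrite -geometric_sum mulrC mulKf ?gt_eqF.
have -> : \sum_(i < n) \sum_(j < n) b ^+ natdist i j =
    (n%:R * (1 + b) - 2 * b * ((1 - b ^+ n) / (1 - b))) / (1 - b).
  by rewrite -Sn -Wn mulrC mulKf ?gt_eqF.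
have -> : (n%:R * (1 + b) - 2 * b * ((1 - b ^+ n) / (1 - b))) / (1 - b) -
    n%:R * ((1 + b) / (1 - b)) = - (2 * b * (1 - b ^+ n)) / (1 - b) ^+ 2.
  by field; rewrite gt_eqF.
rewrite normrM [X in _ * X]ger0_norm ?invr_ge0 ?sqr_ge0 //.
rewrite ler_wpM2r ?invr_ge0 ?sqr_ge0 // normrN !normrM ger0_norm //.
have bn : `|1 - b ^+ n| <= 2.
  apply: le_trans (ler_normB _ _) _; rewrite normr1 normrX.
  have : `|b| ^+ n <= 1 by rewrite exprn_ile1 // ltW.
  by lra.
have -> : 4 = 2 * 1 * 2 :> R by ring.
by rewrite !ler_pM ?mulr_ge0 // ltW.
Qed.

Lemma min_dist_power_sum_le b c n : 0 <= b < 1 -> 0 <= c < 1 ->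
  \sum_(i < n) \sum_(j < n) b ^+ minn i j * c ^+ natdist i j <=
  2 / ((1 - b) * (1 - c)).
Proof.
move=> hb hc; move: (hb) (hc) => /andP[b0 b1] /andP[c0 c1].
(* [F] keeps the triangle i <= j, where the sum factors into geometric series in i and j - i. The
   two triangles give the factor 2; counting the diagonal twice only enlarges the bound. *)
pose F (i j : nat) := if (i <= j)%N then b ^+ i * c ^+ (j - i) else 0.
have F0 i j : 0 <= F i j.
  by rewrite /F; case: ifP => // _; rewrite mulr_ge0 ?exprn_ge0.
have sumF : \sum_(i < n) \sum_(j < n) F i j <= ((1 - b) * (1 - c))^-1.
  apply: (@le_trans _ _ (\sum_(i < n) b ^+ i * (1 - c)^-1)); last first.
    rewrite -mulr_suml invfM ler_wpM2r ?geometric_sum_le //.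
    by rewrite invr_ge0; lra.
  apply: ler_sum => i _.
  rewrite -(big_mkord xpredT (F i)) /= (big_cat_nat (n := i)) //=; last exact: ltnW.
  rewrite big_nat big1 ?add0r; last first.
    by move=> j /= ji; rewrite /F leqNgt ji.
  rewrite -[X in index_iota X _]add0n big_addn big_mkord.
  apply: (@le_trans _ _ (\sum_(k < n - i) b ^+ i * c ^+ k)).
    by apply: ler_sum => k _; rewrite /F leq_addl addnK.
  by rewrite -mulr_sumr ler_wpM2l ?exprn_ge0 ?geometric_sum_le.
have le2 i j : b ^+ minn i j * c ^+ natdist i j <= F i j + F j i.
  have [ij|ji] := leqP i j.
    rewrite {1}/F ij /natdist.
    by rewrite (eqP ij) add0n lerDl.
  rewrite {2}/F (ltnW ji) /natdist.
  by rewrite (eqP (ltnW ji)) addn0 lerDr.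
apply: (@le_trans _ _ (\sum_(i < n) \sum_(j < n) (F i j + F j i))).
  by apply: ler_sum => i _; apply: ler_sum => j _.
under eq_bigr => i _ do rewrite big_split /=.
rewrite big_split /= [X in _ + X]exchange_big /=.
by rewrite mulrDl mul1r lerD.
Qed.

End GeometricSums.

(** * The weighted inner product and the mean *)

Section WeightedSums.
Variables (R : realType) (D : finType) (pi : D -> R).
Hypothesis hpi : distribution pi.
Implicit Types f g h : D -> R.

Lemma inner_ge0 f : 0 <= inner pi f f.
Proof. by apply: sumr_ge0 => x _; rewrite mulr_ge0 ?hpi.1 // -expr2 sqr_ge0. Qed.

Lemma innerC f g : inner pi f g = inner pi g f.
Proof. by apply: eq_bigr => x _; rewrite (mulrC (f x)). Qed.

Lemma innerBl f h g : inner pi (fun x => f x - h x) g = inner pi f g - inner pi h g.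
Proof. by rewrite /inner -sumrB; apply: eq_bigr => x _; rewrite !mulrBl. Qed.

Lemma inner_cstl c g : inner pi (fun=> c) g = c * mean pi g.
Proof. by rewrite /inner /mean mulr_sumr; apply: eq_bigr => x _; rewrite mulrA. Qed.

(** Lagrange's identity: the defect is half the weighted double sum of (f(x) g(y) - f(y) g(x))^2. *)
Lemma inner_cauchy_schwarz f g :
  inner pi f g ^+ 2 <= inner pi f f * inner pi g g.
Proof.
have : 0 <= \sum_x \sum_y (f x * g y - f y * g x) ^+ 2 * (pi x * pi y).
  apply: sumr_ge0 => x _; apply: sumr_ge0 => y _.
  by rewrite mulr_ge0 ?sqr_ge0 // mulr_ge0 ?hpi.1.
suff -> : \sum_x \sum_y (f x * g y - f y * g x) ^+ 2 * (pi x * pi y) =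
  inner pi f f * inner pi g g + inner pi g g * inner pi f f
  - 2 * (inner pi f g * inner pi f g) by lra.
rewrite /inner !big_distrlr /= mulr_sumr -!big_split -sumrB /=.
apply: eq_bigr => x _; rewrite mulr_sumr -!big_split -sumrB /=.
by apply: eq_bigr => y _; ring.
Qed.

Lemma inner11 : inner pi (fun=> 1) (fun=> 1) = 1.
Proof. by rewrite -[RHS]hpi.2; apply: eq_bigr => x _; rewrite !mul1r. Qed.

Lemma mean_sqr_le f : mean pi f ^+ 2 <= inner pi f f.
Proof.
by have := inner_cauchy_schwarz (fun=> 1) f; rewrite inner_cstl inner11 !mul1r.
Qed.

Lemma mean_norm_le f c : (forall x, `|f x| <= c) -> `|mean pi f| <= c.
Proof.
move=> fc; apply: le_trans (ler_norm_sum _ _ _) _.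
apply: (@le_trans _ _ (\sum_x c * pi x)); last by rewrite -mulr_sumr hpi.2 mulr1.
apply: ler_sum => x _; rewrite normrM (ger0_norm (hpi.1 x)).
by rewrite ler_wpM2r ?hpi.1.
Qed.

Lemma mean_cst c : mean pi (fun=> c) = c.
Proof. by rewrite /mean -mulr_sumr hpi.2 mulr1. Qed.

Lemma inner_center f :
  inner pi (fun x => f x - mean pi f) (fun x => f x - mean pi f) =
  inner pi f f - mean pi f ^+ 2.
Proof.
rewrite innerBl innerC innerBl inner_cstl -/(mean pi f).
rewrite inner_cstl; set c := mean pi f.
have -> : mean pi (fun x => f x - c) = 0.
  by rewrite /mean; under eq_bigr => x _ do rewrite mulrBl;
     rewrite sumrB -mulr_sumr hpi.2 mulr1 subrr.
by rewrite mulr0 subr0.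
Qed.

Lemma inner_center_le f :
  inner pi (fun x => f x - mean pi f) (fun x => f x - mean pi f) <= inner pi f f.
Proof. by rewrite inner_center gerBl sqr_ge0. Qed.

End WeightedSums.

(** * Iterates of the Markov operator and self-adjointness *)

Section MarkovOperator.
Variables (R : realType) (D : finType) (pi : D -> R) (p : D -> D -> R).
Hypotheses (hpi : distribution pi) (hp : stochastic p) (hrev : reversible pi p).
Implicit Types f g h : D -> R.
Local Notation P m := (iter m (markov_op p)).

Lemma markov_iterE m h x : P m h x = \sum_y transition_pow p m x y * h y.
Proof.
elim: m x => [|m IH] x /=.
  rewrite (bigD1 x) //= eqxx mul1r big1 ?addr0 // => y.
  by rewrite eq_sym => /negbTE ->; rewrite mul0r.
under [RHS]eq_bigr => y _ do rewrite mulr_suml.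
rewrite exchange_big /=; apply: eq_bigr => z _.
by rewrite IH mulr_sumr; apply: eq_bigr => y _; rewrite mulrA.
Qed.

Lemma transition_pow_distribution m : stochastic (transition_pow p m).
Proof.
elim: m => [|m IH] x /=; split=> /=.
- by [].
- by rewrite (bigD1 x) //= eqxx big1 ?addr0 // => y /negbTE; rewrite eq_sym => ->.
- by move=> y; apply: sumr_ge0 => z _; rewrite mulr_ge0 ?(hp x).1 ?(IH z).1.
- rewrite exchange_big /= -[RHS](hp x).2; apply: eq_bigr => z _.
  by rewrite -mulr_sumr (IH z).2 mulr1.
Qed.

Lemma markov_iter_mean m h x : P m h x = mean (transition_pow p m x) h.
Proof. by rewrite markov_iterE; apply: eq_bigr => y _; rewrite mulrC. Qed.

Lemma markov_iter_norm_le m h c x : (forall y, `|h y| <= c) -> `|P m h x| <= c.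
Proof.
by rewrite markov_iter_mean; apply: mean_norm_le; apply: transition_pow_distribution.
Qed.

Lemma markov_iterB m g h x : P m (fun y => g y - h y) x = P m g x - P m h x.
Proof. by rewrite !markov_iterE -sumrB; apply: eq_bigr => y _; rewrite mulrBr. Qed.

Lemma markov_iter_cst m c x : P m (fun=> c) x = c.
Proof. by rewrite markov_iter_mean mean_cst //; apply: transition_pow_distribution. Qed.

Lemma inner_markov_op g h : inner pi (markov_op p g) h = inner pi g (markov_op p h).
Proof.
rewrite /inner /markov_op; under eq_bigr => x _ do rewrite !mulr_suml.
rewrite exchange_big /=; apply: eq_bigr => y _.
rewrite mulr_sumr mulr_suml; apply: eq_bigr => x _.
have := hrev x y; set a := p x y; set b := p y x => E.
by transitivity (pi x * a * (g y * h x)); [ring|rewrite E; ring].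
Qed.

Lemma inner_markov_iter m g h : inner pi (P m g) h = inner pi g (P m h).
Proof. by elim: m h => // m IH h; rewrite /= inner_markov_op IH -iterSr. Qed.

(** Stationarity of [pi]: self-adjointness moves the iterate onto the constant 1, which it fixes. *)
Lemma mean_markov_iter m h : mean pi (P m h) = mean pi h.
Proof.
rewrite -[LHS]mul1r -inner_cstl -inner_markov_iter.
rewrite -[RHS]mul1r -inner_cstl.
by apply: eq_bigr => x _; rewrite markov_iter_cst.
Qed.

(** Self-adjointness of the iterate, tested on two point indicators. *)
Lemma transition_pow_reversible m : reversible pi (transition_pow p m).
Proof.
move=> x y.
have := inner_markov_iter m (fun z => (z == y)%:R) (fun z => (z == x)%:R).
have E a b : P m (fun z => (z == a)%:R) b = transition_pow p m b a.
  rewrite markov_iterE (bigD1 a) //= eqxx mulr1 big1 ?addr0 //.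
  by move=> z /negbTE ->; rewrite mulr0.
rewrite /inner (bigD1 x) //= eqxx big1 ?addr0; last first.
  by move=> z /negbTE ->; rewrite mulr0 mul0r.
rewrite [RHS](bigD1 y) //= eqxx big1 ?addr0; last first.
  by move=> z /negbTE ->; rewrite !mul0r.
by rewrite !E mulr1 mul1r mulrC => ->; rewrite mulrC.
Qed.

(** * Consequences of irreducibility and aperiodicity *)

Section Ergodic.
Hypothesis herg : ergodic p.

(** A zero of [pi] at x spreads by reversibility of p^n to every y that reaches x, that is
    everywhere, contradicting total mass 1. *)
Lemma stationary_gt0 x : 0 < pi x.
Proof.
rewrite lt_neqAle hpi.1 andbT eq_sym; apply/negP => /eqP px0.
suff s0 : \sum_y pi y = 0 by move: hpi.2; rewrite s0 => /eqP; rewrite eq_sym oner_eq0.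
apply: big1 => y _; have [n n0 pn] := herg.1 y x.
have := transition_pow_reversible n y x; rewrite px0 mul0r => /eqP.
by rewrite mulf_eq0 (gt_eqF pn) orbF => /eqP.
Qed.

Lemma markov_eigen_iter (l : R) h m x :
  (forall y, markov_op p h y = l * h y) -> P m h x = l ^+ m * h x.
Proof.
move=> hl; elim: m x => [|m IH] x /=; first by rewrite mul1r.
rewrite /markov_op; under eq_bigr => y _ do rewrite IH mulrCA.
by rewrite -mulr_sumr [X in _ * X](hl x) exprSr mulrA.
Qed.

(* Maximum principle: at a point where |h| is maximal, P^n h is a convex
   combination of values of h that are at most as large. *)
Lemma eigen_extremal (l : R) h x :
  (forall y, markov_op p h y = l * h y) -> 1 <= `|l| ->
  (forall y, `|h y| <= `|h x|) -> h x != 0 ->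
  `|l| = 1 /\
  forall n y, 0 < transition_pow p n x y -> h y = l ^+ n * h x.
Proof.
move=> hl l1 hmax hx0; have hx : 0 < `|h x| by rewrite normr_gt0.
have L1 : `|l| = 1.
  apply/eqP; rewrite eq_le l1 andbT.
  rewrite -(ler_pM2r hx) mul1r -normrM -[l]expr1 -(markov_eigen_iter 1 x hl).
  exact: markov_iter_norm_le.
split=> // n y pxy.
have ln : l ^+ n * l ^+ n = 1.
  by rewrite -expr2 -exprM mulnC exprM -real_normK ?num_real // L1 !expr1n.
(* [s] is the value to be forced on h(y). The terms p^n(x,z)(s^2 - s h(z)) are nonnegative because
   |h(z)| <= |s|, and they add up to 0 because P^n h(x) = s; so each vanishes. *)
pose s := l ^+ n * h x.
have s2 : s * s = `|h x| ^+ 2.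
  by rewrite real_normK ?num_real // /s expr2 mulrACA ln mul1r.
have nonneg z : 0 <= transition_pow p n x z * (s * s - s * h z).
  rewrite mulr_ge0 ?(transition_pow_distribution n x).1 //.
  rewrite subr_ge0 (le_trans (ler_norm _)) // normrM s2 expr2.
  by rewrite /s normrM normrX L1 expr1n mul1r ler_wpM2l.
have : \sum_z transition_pow p n x z * (s * s - s * h z) = 0.
  rewrite (eq_bigr (fun z => s * s * transition_pow p n x z -
    s * (transition_pow p n x z * h z))) => [|z _]; last by ring.
  rewrite sumrB -!mulr_sumr -markov_iterE (transition_pow_distribution n x).2.
  by rewrite (markov_eigen_iter _ _ hl) mulr1 subrr.
move/eqP; rewrite psumr_eq0 => [|z _]; last exact: nonneg.
move=> /allP /(_ y); rewrite mem_index_enum => /(_ isT) /=.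
rewrite mulf_eq0 (gt_eqF pxy) /= -mulrBr mulf_eq0 => /orP[/eqP s0|].
  by move: s2; rewrite s0 mul0r => /eqP; rewrite eq_sym expf_eq0 /= (gt_eqF hx).
by rewrite subr_eq0 => /eqP <-.
Qed.

(** Otherwise the maximum principle leaves l = 1 or l = -1. For l = 1 irreducibility makes h
    constant, hence zero by orthogonality to 1. *)
Lemma ergodic_eigenvalue_lt1 (l : R) h :
  (forall y, markov_op p h y = l * h y) ->
  inner pi h (fun=> 1) = 0 -> inner pi h h = 1 -> `|l| < 1.
Proof.
move=> hl h1 hh; rewrite ltNge; apply/negP => l1.
have [x0 hx0] : exists x, h x != 0.
  apply/existsP/contraT; rewrite negb_exists => /forallP h0.
  move: hh; rewrite /inner big1 => [/eqP|x _]; first by rewrite eq_sym oner_eq0.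
  by move: (h0 x); rewrite negbK => /eqP ->; rewrite !mul0r.
pose x := [arg max_(z > x0) `|h z|]%O.
have hmax y : `|h y| <= `|h x| by rewrite /x; case: arg_maxP => // z _; apply.
have hx : h x != 0 by rewrite -normr_gt0 (lt_le_trans _ (hmax x0)) ?normr_gt0.
have [L1 prop] := eigen_extremal hl l1 hmax hx.
have [l_eq|l_eq] : l = 1 \/ l = -1.
  have : l ^+ 2 = 1 by rewrite -real_normK ?num_real // L1 expr1n.
  by move/eqP; rewrite sqrf_eq1 => /orP[] /eqP; [left|right].
  have cst y : h y = h x.
    have [n n0 pn] := herg.1 x y.
    by rewrite (prop n y pn) l_eq expr1n mul1r.
  move: h1; rewrite innerC inner_cstl mul1r /mean.
  under eq_bigr => y _ do rewrite cst.
  by rewrite -mulr_sumr hpi.2 mulr1 => /eqP; exact/negP.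
(* Here l = -1: a return to x at an odd time would give h(x) = -h(x), so 2 divides all return times,
   against aperiodicity. *)
suff : 2%N = 1%N by [].
apply: (herg.2 x) => n n0 pn; have := prop n x pn.
rewrite l_eq dvdn2 -signr_odd; case: (odd n) => //; rewrite expr1 => E.
by exfalso; move/eqP: hx; apply; lra.
Qed.

End Ergodic.
End MarkovOperator.

(** * Expansion in the eigenbasis and contraction off the constants *)

Section SpectralDecomposition.
Variables (R : realType) (D : finType) (pi : D -> R) (p : D -> D -> R).
Variables (beta : nat -> R) (u : nat -> D -> R).
Hypotheses (hD : (2 <= #|D|)%N).
Hypotheses (hpi : distribution pi) (hp : stochastic p) (hrev : reversible pi p).
Hypotheses (herg : ergodic p) (hu : spectral_basis pi p beta u).
Implicit Types f g h : D -> R.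
Local Notation P m := (iter m (markov_op p)).
Local Notation b := (beta_abs D beta).
Local Notation center f := (fun x => f x - mean pi f).

(* The matrices (u_k(x)) and (pi(x) u_k(x)) are mutually inverse: orthonormality
   is one order of the product, completeness the other. *)
Lemma spectral_complete x y :
  \sum_(0 <= k < #|D|) pi x * u k x * u k y = (x == y)%:R.
Proof.
have [_ _ orth _] := hu.
pose A : 'M[R]_#|D| := \matrix_(k, i) u k (enum_val i).
pose B : 'M[R]_#|D| := \matrix_(i, k) (pi (enum_val i) * u k (enum_val i)).
have AB : A *m B = 1%:M.
  apply/matrixP => k l; rewrite !mxE -(inj_eq val_inj).
  rewrite -(orth _ _ (ltn_ord k) (ltn_ord l)).
  rewrite /inner (reindex (@enum_val D D)) /=; last first.
    by exists enum_rank => z _; rewrite ?enum_valK ?enum_rankK.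
  by apply: eq_bigr => i _; rewrite !mxE; ring.
have /matrixP /(_ (enum_rank x) (enum_rank y)) := mulmx1C AB.
rewrite !mxE (inj_eq enum_rank_inj) => <-; rewrite big_mkord.
by apply: eq_bigr => k _; rewrite !mxE !enum_rankK.
Qed.

(** The sum is written over pairs (x, y) with a Kronecker delta; replacing the delta by the
    completeness kernel makes it factor. *)
Lemma spectral_parseval f g :
  inner pi f g = \sum_(0 <= k < #|D|) inner pi f (u k) * inner pi g (u k).
Proof.
transitivity (\sum_x \sum_y (f x * g y * pi y) * (x == y)%:R).
  apply: eq_bigr => x _; rewrite (bigD1 x) //= eqxx mulr1 big1 ?addr0 //.
  by move=> y; rewrite eq_sym => /negbTE ->; rewrite mulr0.
under eq_bigr => x _ do under eq_bigr => y _ do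
  rewrite -spectral_complete mulr_sumr.
under eq_bigr => x _ do rewrite exchange_big /=.
rewrite exchange_big /=; apply: eq_bigr => k _.
rewrite /inner big_distrlr /=.
by apply: eq_bigr => x _; apply: eq_bigr => y _; ring.
Qed.

Lemma spectral_u0 x : u 0%N x = 1. Proof. by have [] := hu. Qed.

Lemma inner_u0 f : inner pi f (u 0%N) = mean pi f.
Proof. by apply: eq_bigr => x _; rewrite spectral_u0 mulr1. Qed.

Lemma mean_u k : (1 <= k < #|D|)%N -> mean pi (u k) = 0.
Proof.
move=> /andP[k0 kD]; rewrite -inner_u0; have [_ _ -> //] := hu.
  by case: k k0 {kD}.
exact: leq_trans hD.
Qed.

Lemma inner_center_u k f : (1 <= k < #|D|)%N ->
  inner pi (center f) (u k) = inner pi f (u k).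
Proof. by move=> hk; rewrite innerBl inner_cstl mean_u // mulr0 subr0. Qed.

Lemma mean_center f : mean pi (center f) = 0.
Proof.
rewrite -inner_u0 innerBl inner_cstl inner_u0.
suff -> : mean pi (u 0%N) = 1 by rewrite mulr1 subrr.
by rewrite -(mean_cst hpi 1); apply: eq_bigr => x _; rewrite spectral_u0.
Qed.

(** Centering f already kills the k = 0 term, so g may stay uncentered. *)
Lemma spectral_parseval_center f g :
  inner pi (center f) g =
  \sum_(1 <= k < #|D|) inner pi f (u k) * inner pi g (u k).
Proof.
rewrite spectral_parseval big_ltn 1?(leq_trans _ hD) // inner_u0 mean_center.
rewrite mul0r add0r !big_nat; apply: eq_bigr => k hk.
by rewrite inner_center_u.
Qed.

Lemma inner_markov_u m k f : (k < #|D|)%N ->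
  inner pi (P m f) (u k) = beta k ^+ m * inner pi f (u k).
Proof.
move=> kD; rewrite inner_markov_iter // /inner mulr_sumr.
apply: eq_bigr => x _; rewrite (markov_eigen_iter m x (l := beta k)); first by ring.
by move=> y; have [_ ->] := hu.
Qed.

Lemma spectral_beta_lt1 k : (1 <= k < #|D|)%N -> `|beta k| < 1.
Proof.
move=> hk; have [_ hev orth _] := hu; have /andP[k0 kD] := hk.
apply: (ergodic_eigenvalue_lt1 hpi hp herg (h := u k)).
- by move=> y; apply: hev.
- by rewrite innerC inner_cstl mean_u ?mulr0.
- by rewrite orth // eqxx.
Qed.

Lemma spectral_beta_le1 k : (1 <= k < #|D|)%N -> beta k <= beta 1%N.
Proof. by move=> /andP[k0 kD]; have [_ _ _ ->] := hu. Qed.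

Lemma spectral_beta_le k : (1 <= k < #|D|)%N -> `|beta k| <= b.
Proof.
move=> hk; have [_ _ _ mono] := hu; have /andP[k0 kD] := hk.
have D0 : (0 < #|D|)%N by apply: leq_trans hD.
have le_last : beta #|D|.-1 <= beta k by apply: mono; [rewrite -ltnS prednK|rewrite ltn_predL].
have le1 := spectral_beta_le1 hk.
have := ler_norm (- beta #|D|.-1); rewrite normrN => le_abs.
rewrite /beta_abs; set c := Num.max _ _.
have c1 : beta 1%N <= c by rewrite /c le_max lexx.
have c2 : `|beta #|D|.-1| <= c by rewrite /c le_max lexx orbT.
by rewrite ler_norml; lra.
Qed.

Lemma beta_abs_bounds : 0 <= b < 1.
Proof.
have D0 : (0 < #|D|)%N by apply: leq_trans hD.
rewrite /beta_abs le_max normr_ge0 orbT gt_max.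
rewrite (le_lt_trans (ler_norm _)) ?spectral_beta_lt1 //.
by case: #|D| hD => [|[]] //= n _; rewrite ltnSn.
Qed.

(** Centering removes the eigenvalue 1, and every other coordinate is multiplied by beta_k^m, of
    modulus at most b^m. *)
Lemma markov_iter_contraction m h :
  inner pi (center (P m h)) (center (P m h)) <= b ^+ m ^+ 2 * inner pi h h.
Proof.
have /andP[b0 b1] := beta_abs_bounds.
apply: (@le_trans _ _ (b ^+ m ^+ 2 * inner pi (center h) (center h))); last first.
  by rewrite ler_wpM2l ?inner_center_le // sqr_ge0.
rewrite !spectral_parseval_center mulr_sumr big_nat [leRHS]big_nat.
apply: ler_sum => k hk; have /andP[k0 kD] := hk.
rewrite !inner_center_u // !inner_markov_u // mulrACA -!expr2.
rewrite ler_wpM2r ?sqr_ge0 // -[leLHS]real_normK ?num_real //.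
by rewrite ler_pXn2r ?nnegrE ?exprn_ge0 // normrX lerXn2r ?nnegrE // spectral_beta_le.
Qed.

(** The stationary autocovariance at lag m, diagonalised. *)
Lemma inner_center_markov_iter m f :
  inner pi (center f) (P m (center f)) =
  \sum_(1 <= k < #|D|) inner pi f (u k) ^+ 2 * beta k ^+ m.
Proof.
rewrite spectral_parseval_center !big_nat; apply: eq_bigr => k hk.
have /andP[k0 kD] := hk.
by rewrite inner_markov_u // inner_center_u //; ring.
Qed.

End SpectralDecomposition.

(** * One-time and two-time expectations along the chain *)

Section ChainExpectation.
Variables (R : realType) (D : finType) (p : D -> D -> R).
Hypothesis hp : stochastic p.
Implicit Types f g h : D -> R.
Local Notation P m := (iter m (markov_op p)).

Lemma sum_tuple0 (F : seq D -> R) : \sum_(w : 0.-tuple D) F w = F [::].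
Proof.
rewrite (big_pred1 [tuple]) // => w; rewrite [w]tuple0.
by apply/esym/eqP.
Qed.

Lemma sum_tuple_cons m (F : seq D -> R) :
  \sum_(w : m.+1.-tuple D) F w = \sum_x \sum_(w : m.-tuple D) F (x :: w).
Proof.
rewrite pair_bigA (reindex (fun q : D * m.-tuple D => [tuple of q.1 :: q.2])) //=.
exists (fun w => (thead w, [tuple of behead w])) => [[x w] _|w _] /=.
  by rewrite theadE; congr pair; apply: val_inj.
by rewrite [RHS]tuple_eta.
Qed.

Lemma path_mass_sum m x : \sum_(w : m.-tuple D) path_mass p x w = 1.
Proof.
elim: m x => [|m IH] x; first by rewrite sum_tuple0.
rewrite sum_tuple_cons /= -[RHS](hp x).2; apply: eq_bigr => y _.
by rewrite -mulr_sumr IH mulr1.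
Qed.

Lemma path_mass_ge0 x s : 0 <= path_mass p x s.
Proof. by elim: s x => //= y s IH x; rewrite mulr_ge0 ?(hp x).1. Qed.

Lemma chain_mass_ge0 nu s : distribution nu -> 0 <= chain_mass nu p s.
Proof. by case: s => //= x s [nu0 _]; rewrite mulr_ge0 ?path_mass_ge0. Qed.

(** With x at time 0, the states after time b sum out to mass 1. The default [x0] is never reached,
    since x :: w has m + 1 > b entries. *)
Lemma path_sum_nth m x x0 b h : (b <= m)%N ->
  \sum_(w : m.-tuple D) h (nth x0 (x :: w) b) * path_mass p x w = P b h x.
Proof.
elim: m x b => [|m IH] x [|b] // bm.
- by rewrite (sum_tuple0 (fun w => h x * path_mass p x w)) /= mulr1.
- by rewrite /= -mulr_sumr path_mass_sum mulr1.
rewrite (sum_tuple_cons _ (fun w => h (nth x0 (x :: w) b.+1) * path_mass p x w)).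
rewrite iterS; apply: eq_bigr => y _ /=.
rewrite -(IH y b) // mulr_sumr; apply: eq_bigr => w _.
by rewrite mulrCA.
Qed.

(** Markov property at time a: given the state there, the later factor averages to P^(b-a) h. *)
Lemma path_sum_nth2 m x x0 a b g h : (a <= b)%N -> (b <= m)%N ->
  \sum_(w : m.-tuple D)
    g (nth x0 (x :: w) a) * h (nth x0 (x :: w) b) * path_mass p x w =
  P a (fun y => g y * P (b - a) h y) x.
Proof.
elim: m x a b => [|m IH] x [|a] b // ab bm.
- move: bm; rewrite leqn0 => /eqP ->.
  by rewrite (sum_tuple0 (fun w => g x * h x * path_mass p x w)) /= mulr1.
- by move: bm ab; rewrite leqn0 => /eqP ->.
- rewrite subn0 [RHS]/= -(path_sum_nth _ x0 _ bm) mulr_sumr.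
  by apply: eq_bigr => w _; rewrite mulrA.
case: b ab bm => // b ab bm.
rewrite (sum_tuple_cons _ (fun w =>
  g (nth x0 (x :: w) a.+1) * h (nth x0 (x :: w) b.+1) * path_mass p x w)).
rewrite iterS; apply: eq_bigr => y _ /=.
rewrite subSS -(IH y a b) // mulr_sumr; apply: eq_bigr => w _.
by rewrite mulrCA.
Qed.

Lemma chain_sum_nth2 nu N x0 a b g h : (a <= b)%N -> (b < N)%N ->
  \sum_(w : N.-tuple D) g (nth x0 w a) * h (nth x0 w b) * chain_mass nu p w =
  mean nu (P a (fun y => g y * P (b - a) h y)).
Proof.
case: N => // N ab bN.
rewrite (sum_tuple_cons _ (fun w => g (nth x0 w a) * h (nth x0 w b) * chain_mass nu p w)).
apply: eq_bigr => x _ /=.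
rewrite -(path_sum_nth2 x x0 _ _ ab bN) mulr_suml; apply: eq_bigr => w _.
by rewrite mulrCA mulrC.
Qed.

(** The square is expanded over pairs of times and the Markov property applied at the earlier one.
    The burn-in shifts both times, so it enters the minimum but not the distance. *)
Lemma error_sqr pi nu n n0 f : (0 < n)%N -> distribution nu ->
  let g := fun x => f x - mean pi f in
  error pi nu p n n0 f ^+ 2 =
  (n%:R ^+ 2)^-1 * \sum_(i < n) \sum_(j < n)
    mean nu (P (n0 + minn i j) (fun y => g y * P (natdist i j) g y)).
Proof.
move=> n_gt0 hnu g.
have n_neq0 : n%:R != 0 :> R by rewrite pnatr_eq0 -lt0n.
(* [nth] needs a default state; D is inhabited because [nu] has mass 1. *)
have [x0 _] : exists x : D, true.
  apply/existsP/contraT => /existsPn noD; have := hnu.2.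
  by rewrite big1 => [/eqP|x _]; [rewrite eq_sym oner_eq0|have := noD x].
rewrite /error sqr_sqrtr; last first.
  by apply: sumr_ge0 => w _; rewrite mulr_ge0 ?sqr_ge0 ?chain_mass_ge0.
transitivity ((n%:R ^+ 2)^-1 * \sum_(w : (n0 + n).-tuple D)
  \sum_(i < n) \sum_(j < n)
    g (nth x0 w (n0 + i)) * g (nth x0 w (n0 + j)) * chain_mass nu p w).
  rewrite mulr_sumr; apply: eq_bigr => w _.
  have -> : sample_mean f w - mean pi f =
      n%:R^-1 * \sum_(i < n) g (nth x0 w (n0 + i)).
    rewrite sumrB sumr_const card_ord mulrBr -[X in _ - _ * X]mulr_natl mulKf //.
    rewrite /sample_mean; congr (_ * _ - _); apply: eq_bigr => i _.
    by rewrite (tnth_nth x0).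
  rewrite real_normK ?num_real // exprMn exprVn -mulrA; congr (_ * _).
  rewrite expr2 big_distrlr /= mulr_suml; apply: eq_bigr => i _.
  by rewrite mulr_suml.
congr (_ * _); rewrite exchange_big /=; apply: eq_bigr => i _.
rewrite exchange_big /=; apply: eq_bigr => j _.
have [ij|ji] := leqP i j.
  rewrite chain_sum_nth2 ?leq_add2l ?ltn_add2l // subnDl.
  by rewrite /natdist (eqP ij).
under eq_bigr => w _ do rewrite [X in X * _]mulrC.
rewrite chain_sum_nth2 ?leq_add2l ?ltn_add2l //; last exact: ltnW.
rewrite subnDl.
by rewrite /natdist (eqP (ltnW ji)) addn0.
Qed.

End ChainExpectation.

(** Soft thresholding: removing the part of t clipped to [-s, s] leaves size (|t| - s)_+. This
    splits a function into a bounded part and an l_2 part. *)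
Lemma soft_threshold_sqr (R : realFieldType) (s t : R) : 0 <= s ->
  (t - Num.max (- s) (Num.min s t)) ^+ 2 = Num.max 0 (`|t| - s) ^+ 2.
Proof.
move=> s0; have [t0|t0] := leP 0 t.
  rewrite ger0_norm //; have [st|ts] := leP s t.
    have -> : Num.max (- s) s = s by apply/max_idPr; lra.
    by have -> : Num.max 0 (t - s) = t - s by apply/max_idPr; lra.
  have -> : Num.max (- s) t = t by apply/max_idPr; lra.
  by have -> : Num.max 0 (t - s) = 0 by [apply/max_idPl; lra]; rewrite subrr.
have -> : Num.min s t = t by apply/min_idPr; lra.
rewrite ltr0_norm //; have [st|ts] := leP (- s) t.
  by have -> : Num.max 0 (- t - s) = 0 by [apply/max_idPl; lra]; rewrite subrr.
have -> : Num.max 0 (- t - s) = - t - s by apply/max_idPr; lra.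
by ring.
Qed.

(** * From truncated l_2 estimates to an l_4 estimate *)

Section Interpolation.
Variables (R : realType) (D : finType) (pi : D -> R).
Hypothesis hpi : distribution pi.

(* Dyadic layer-cake sum: up to constants t^4 is the sum of s^2 (t - s)_+^2
   over the scales s = M, M/2, M/4, etc. *)
Fixpoint layer_sum (J : nat) (M t : R) : R :=
  if J is K.+1 then M ^+ 2 * Num.max 0 (t - M) ^+ 2 + layer_sum K (M / 2) t
  else 0.

(** For t <= M the top layer vanishes; for t > M it is at most t^2 M^2, and 1 + (4/3)/4 = 4/3 closes
    the induction. The minimum carries the decay over scales. *)
Lemma layer_sum_le J (M t : R) : 0 <= t -> 0 <= M ->
  layer_sum J M t <= 4 / 3 * t ^+ 2 * Num.min t M ^+ 2.
Proof.
move=> t0; elim: J M => [|J IH] M M0 /=.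
  by rewrite mulr_ge0 ?sqr_ge0 // mulr_ge0 ?sqr_ge0 // divr_ge0.
have M20 : 0 <= M / 2 by lra.
have t2 := sqr_ge0 t; have c43 : 0 <= 4 / 3 :> R by lra.
apply: le_trans (lerD (lexx _) (IH _ M20)) _.
have [tM|Mt] := leP t M.
  have -> : Num.max 0 (t - M) = 0 by apply/max_idPl; lra.
  rewrite expr0n mulr0 add0r ler_wpM2l ?(mulr_ge0 c43 t2) //.
  rewrite lerXn2r ?nnegrE ?le_min ?t0 ?M20 //.
  by rewrite ge_min lexx.
have -> : Num.max 0 (t - M) = t - M by apply/max_idPr; lra.
have -> : Num.min t (M / 2) = M / 2 by apply/min_idPr; lra.
suff : 0 <= M ^+ 2 * (t ^+ 2 - (t - M) ^+ 2) by lra.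
by rewrite mulr_ge0 ?sqr_ge0 //; nra.
Qed.

Lemma layer_sum_le4 J (M t : R) : 0 <= t -> 0 <= M ->
  layer_sum J M t <= 4 / 3 * t ^+ 4.
Proof.
move=> t0 M0; apply: le_trans (layer_sum_le _ t0 M0) _.
rewrite -mulrA ler_wpM2l ?divr_ge0 // (exprD t 2 2) ler_wpM2l ?sqr_ge0 //.
by rewrite lerXn2r ?nnegrE ?le_min ?t0 // ge_min lexx.
Qed.

Lemma layer_sum_ge0 J (M t : R) : 0 <= layer_sum J M t.
Proof.
by elim: J M => //= J IH M; rewrite addr_ge0 // mulr_ge0 ?sqr_ge0.
Qed.

(** At a scale with 2M < t <= 4M one has M >= t/4 and t - M >= t/2, so this single layer is at least
    t^4/64. If no scale gets there, t <= 4M/2^J, whence the remainder with 256 = 4^4. *)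
Lemma layer_sum_ge J (M t : R) : 0 <= t -> t <= 4 * M ->
  t ^+ 4 <= 64 * layer_sum J M t + 256 * (M / 2 ^+ J) ^+ 4.
Proof.
move=> t0; elim: J M => [|J IH] M tM /=.
  rewrite expr0 divr1 mulr0 add0r.
  have -> : 256 * M ^+ 4 = (4 * M) ^+ 4 by ring.
  by rewrite lerXn2r ?nnegrE //; lra.
have [tM2|Mt2] := leP t (2 * M).
  have -> : M / 2 ^+ J.+1 = M / 2 / 2 ^+ J by rewrite exprS invfM mulrA.
  apply: (le_trans (IH (M / 2) _)); first by lra.
  rewrite lerD2r ler_wpM2l //.
  by rewrite lerDr mulr_ge0 ?sqr_ge0.
have -> : Num.max 0 (t - M) = t - M by apply/max_idPr; lra.
have L0 := layer_sum_ge0 J (M / 2) t.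
have E0 : 0 <= (M / 2 ^+ J.+1) ^+ 4 by rewrite exprn_even_ge0.
suff : t ^+ 4 <= 64 * (M ^+ 2 * (t - M) ^+ 2) by lra.
have -> : t ^+ 4 = 64 * ((t / 4) ^+ 2 * (t / 2) ^+ 2) by field.
rewrite ler_wpM2l // ler_pM ?sqr_ge0 // lerXn2r ?nnegrE //; lra.
Qed.

(* Real interpolation between l_2 and l_oo with exponent 4. *)
Lemma truncated_l2_le_l4 (B : R) (y f : D -> R) : 0 <= B ->
  (forall s, 0 <= s ->
    \sum_x Num.max 0 (`|y x| - 2 * s) ^+ 2 * pi x <=
    B * \sum_x Num.max 0 (`|f x| - s) ^+ 2 * pi x) ->
  \sum_x y x ^+ 4 * pi x <= 1024 * B * \sum_x f x ^+ 4 * pi x.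
Proof.
move=> B0 Hs; pose M := \sum_x `|y x|.
have M0 : 0 <= M by apply: sumr_ge0.
have yM x : `|y x| <= M by rewrite /M (bigD1 x) //= lerDl sumr_ge0.
have E4 (z : R) : z ^+ 4 = `|z| ^+ 4 by rewrite -normrX ger0_norm ?exprn_even_ge0.
(* Halving y turns the threshold 2s of the hypothesis into s; squaring the half gives B/4. *)
have layers J N : 0 <= N -> \sum_x layer_sum J N (`|y x| / 2) * pi x <=
    B / 4 * \sum_x layer_sum J N `|f x| * pi x.
  elim: J N => [|J IH] N N0 /=.
    by rewrite !big1 ?mulr0 // => x _; rewrite mul0r.
  have split_sum (a : D -> R) :
      \sum_x (N ^+ 2 * Num.max 0 (a x - N) ^+ 2 + layer_sum J (N / 2) (a x)) * pi x =
      N ^+ 2 * (\sum_x Num.max 0 (a x - N) ^+ 2 * pi x) +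
      \sum_x layer_sum J (N / 2) (a x) * pi x.
    by rewrite mulr_sumr -big_split /=; apply: eq_bigr => x _; rewrite mulrDl mulrA.
  rewrite !split_sum mulrDr lerD ?IH //; last by lra.
  rewrite mulrCA ler_wpM2l ?sqr_ge0 //.
  rewrite mulrAC ler_pdivlMr // mulrC mulr_sumr.
  rewrite (eq_bigr (fun x => Num.max 0 (`|y x| - 2 * N) ^+ 2 * pi x)) ?Hs // => x _.
  have -> : `|y x| - 2 * N = 2 * (`|y x| / 2 - N) by field.
  by rewrite -[X in _ = Num.max X _ ^+ 2 * _](mulr0 2) -maxr_pMr //; ring.
apply/ler_addgt0Pr => e e0.
(* Enough scales to make the remainder, of total weight 4096 = 16 * 256, at most the arbitrary e. *)
pose J := (Num.trunc (4096 * M ^+ 4 / e)).+1.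
have HJ : 4096 * (M / 2 ^+ J) ^+ 4 <= e.
  have J2 : 4096 * M ^+ 4 / e <= (2 ^+ J) ^+ 4.
    apply: (@le_trans _ _ J%:R); first by rewrite ltW // truncnS_gt.
    rewrite -exprM -natrX ler_nat (leq_trans (ltnW (ltn_expl J (isT : 1 < 2)%N))) //.
    by rewrite leq_exp2l // leq_pmulr.
  rewrite expr_div_n mulrA ler_pdivrMr ?exprn_gt0 //.
  by rewrite -ler_pdivrMl // mulrC.
have key : \sum_x (`|y x| / 2) ^+ 4 * pi x <=
    64 * (B / 4 * (4 / 3 * \sum_x f x ^+ 4 * pi x)) + 256 * (M / 2 ^+ J) ^+ 4.
  apply: (@le_trans _ _ (\sum_x (64 * layer_sum J M (`|y x| / 2) +
      256 * (M / 2 ^+ J) ^+ 4) * pi x)).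
    apply: ler_sum => x _; rewrite ler_wpM2r ?hpi.1 // layer_sum_ge //.
      by rewrite divr_ge0.
    by have := yM x; lra.
  under eq_bigr => x _ do rewrite mulrDl -mulrA.
  rewrite big_split /= -!mulr_sumr hpi.2 mulr1 lerD2r ler_wpM2l //.
  apply: le_trans (layers J M M0) _.
  rewrite ler_wpM2l ?divr_ge0 // mulr_sumr; apply: ler_sum => x _.
  by rewrite mulrA ler_wpM2r ?hpi.1 // E4 layer_sum_le4.
(* Undoing the halving costs 16; the constant is then 16 * 64 * (1/4) * (4/3) = 1024/3, below the
   stated 1024. *)
have -> : \sum_x y x ^+ 4 * pi x = 16 * \sum_x (`|y x| / 2) ^+ 4 * pi x.
  rewrite mulr_sumr; apply: eq_bigr => x _.
  by rewrite [X in X * _ = _]E4; field.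
have F0 : 0 <= B * \sum_x f x ^+ 4 * pi x.
  rewrite mulr_ge0 //; apply: sumr_ge0 => x _.
  by rewrite mulr_ge0 ?hpi.1 // exprn_even_ge0.
move: F0 key HJ; set F := \sum_x f x ^+ 4 * pi x; lra.
Qed.

End Interpolation.

(** * Comparison of the norms and the cost of centering *)

Section MaximumNorm.
Variables (R : realType) (D : finType).
Implicit Types f : D -> R.

Lemma le_linfnorm f x : `|f x| <= linfnorm f.
Proof. exact: (le_bigmax _ (fun x => `|f x|)). Qed.

Lemma linfnorm_ge0 f : 0 <= linfnorm f.
Proof. exact: bigmax_ge_id. Qed.

End MaximumNorm.

Section PowerNorms.
Variables (R : realType) (D : finType) (pi : D -> R).
Hypothesis hpi : distribution pi.
Implicit Types f : D -> R.

Lemma lpnorm2_sqr f : lpnorm pi 2 f ^+ 2 = inner pi f f.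
Proof.
rewrite /lpnorm; under eq_bigr => x _ do
  rewrite powR_mulrn // real_normK ?num_real // expr2.
by rewrite powR12_sqrt ?inner_ge0 // sqr_sqrtr ?inner_ge0.
Qed.

Lemma lpnorm4_pow4 f : (lpnorm pi 4 f ^+ 2) ^+ 2 = \sum_x f x ^+ 4 * pi x.
Proof.
have E : \sum_x `|f x| `^ 4 * pi x = \sum_x f x ^+ 4 * pi x.
  apply: eq_bigr => x _; rewrite powR_mulrn // -normrX ger0_norm //.
  exact: exprn_even_ge0.
rewrite /lpnorm E -exprM -powR_mulrn ?powR_ge0 // -powRrM mulVf ?powRr1 ?pnatr_eq0 //.
by apply: sumr_ge0 => x _; rewrite mulr_ge0 ?hpi.1 ?exprn_even_ge0.
Qed.

Lemma inner_le_lpnorm4 f : inner pi f f <= lpnorm pi 4 f ^+ 2.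
Proof.
rewrite -ler_sqr ?nnegrE ?inner_ge0 ?sqr_ge0 // lpnorm4_pow4.
have -> : inner pi f f = mean pi (fun x => f x ^+ 2) by apply: eq_bigr.
apply: le_trans (mean_sqr_le hpi _) _.
by apply: ler_sum => x _; rewrite -exprD.
Qed.

Lemma inner_le_linfnorm f : inner pi f f <= linfnorm f ^+ 2.
Proof.
rewrite -[leRHS]mulr1 -hpi.2 mulr_sumr; apply: ler_sum => x _.
rewrite ler_wpM2r ?hpi.1 // -expr2 -real_normK ?num_real //.
by rewrite lerXn2r ?nnegrE ?linfnorm_ge0 // le_linfnorm.
Qed.

(** Here 16 = 8 + 8: pointwise (a - e)^4 <= 8a^4 + 8e^4, and the fourth power of the mean is at most
    the fourth moment. *)
Lemma center_pow4_sum f :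
  \sum_x (f x - mean pi f) ^+ 4 * pi x <= 16 * \sum_x f x ^+ 4 * pi x.
Proof.
set F := \sum_x f x ^+ 4 * pi x; set c := mean pi f.
have cF : c ^+ 4 <= F.
  apply: (@le_trans _ _ (inner pi f f ^+ 2)).
    rewrite (exprM c 2 2) lerXn2r ?nnegrE ?sqr_ge0 ?inner_ge0 //.
    exact: mean_sqr_le.
  rewrite /F -lpnorm4_pow4 lerXn2r ?nnegrE ?sqr_ge0 ?inner_ge0 //.
  exact: inner_le_lpnorm4.
have pt (a e : R) : (a - e) ^+ 4 <= 8 * a ^+ 4 + 8 * e ^+ 4.
  have h1 : (a - e) ^+ 2 <= 2 * (a ^+ 2 + e ^+ 2) by have := sqr_ge0 (a + e); lra.
  have h2 : ((a - e) ^+ 2) ^+ 2 <= (2 * (a ^+ 2 + e ^+ 2)) ^+ 2.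
    by rewrite lerXn2r ?nnegrE ?sqr_ge0 // mulr_ge0 // addr_ge0 ?sqr_ge0.
  by have := sqr_ge0 (a ^+ 2 - e ^+ 2); lra.
apply: (@le_trans _ _ (\sum_x (8 * f x ^+ 4 + 8 * c ^+ 4) * pi x)).
  by apply: ler_sum => x _; rewrite ler_wpM2r ?hpi.1.
under eq_bigr => x _ do rewrite mulrDl -mulrA.
by rewrite big_split /= -!mulr_sumr hpi.2 -/F; lra.
Qed.

Lemma center_linfnorm_le f x : `|f x - mean pi f| <= 2 * linfnorm f.
Proof.
apply: le_trans (ler_normB _ _) _; rewrite mulrDl mul1r lerD ?le_linfnorm //.
by apply: mean_norm_le => // y; apply: le_linfnorm.
Qed.

End PowerNorms.

(** * Change of measure, bias and estimates of the products *)

Section ErrorBounds.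
Variables (R : realType) (D : finType) (pi nu : D -> R) (p : D -> D -> R).
Variables (beta : nat -> R) (u : nat -> D -> R).
Hypotheses (hD : (2 <= #|D|)%N).
Hypotheses (hpi : distribution pi) (hp : stochastic p) (hnu : distribution nu).
Hypotheses (hrev : reversible pi p) (herg : ergodic p).
Hypothesis (hu : spectral_basis pi p beta u).
Implicit Types f g h : D -> R.
Local Notation P m := (iter m (markov_op p)).
Local Notation b := (beta_abs D beta).
Local Notation center f := (fun x => f x - mean pi f).
Local Notation product k f :=
  (fun x => (f x - mean pi f) * P k (fun y => f y - mean pi f) x).
Local Notation dens := (fun x => nu x / pi x - 1).

Let pi_gt0 := stationary_gt0 hpi hrev herg.

Lemma mean_density h : mean nu h = mean pi h + inner pi h dens.
Proof.
rewrite /mean /inner -big_split /=; apply: eq_bigr => x _.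
by have := gt_eqF (pi_gt0 x) => /negbT pix; field.
Qed.

Lemma density_mean : mean pi dens = 0.
Proof.
have := mean_density (fun=> 1); rewrite !mean_cst // inner_cstl mul1r.
by move/eqP; rewrite -subr_eq0 opprD addNKr oppr_eq0 => /eqP.
Qed.

(** As the density deviation has [pi]-mean 0, its squared norm equals its own [nu]-mean. Only one
    power of the maximum is lost, hence the square root in the bounds. *)
Lemma density_inner_le : inner pi dens dens <= linfnorm dens.
Proof.
have := mean_density dens; rewrite density_mean add0r => <-.
by apply: le_trans (ler_norm _) _; apply: mean_norm_le => // x; apply: le_linfnorm.
Qed.

(** The density deviation is orthogonal to constants, so P^m h may be centered before Cauchy-Schwarz
    and the contraction apply. *)
Lemma inner_density_le m h A : 0 <= A -> inner pi h h <= A ^+ 2 ->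
  `|inner pi (P m h) dens| <= b ^+ m * A * Num.sqrt (linfnorm dens).
Proof.
move=> A0 hA; have /andP[b0 _] := beta_abs_bounds hD hpi hp herg hu.
have rhs0 : 0 <= b ^+ m * A * Num.sqrt (linfnorm dens).
  by rewrite !mulr_ge0 ?exprn_ge0 ?sqrtr_ge0.
rewrite -ler_sqr ?nnegrE // real_normK ?num_real //.
have -> : inner pi (P m h) dens = inner pi (center (P m h)) dens.
  by rewrite innerBl inner_cstl density_mean mulr0 subr0.
apply: le_trans (inner_cauchy_schwarz hpi _ _) _.
rewrite exprMn sqr_sqrtr ?linfnorm_ge0 // ler_pM ?inner_ge0 ?density_inner_le //.
apply: le_trans (markov_iter_contraction hD hpi hp hrev herg hu _ _) _.
by rewrite exprMn ler_wpM2l ?sqr_ge0.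
Qed.

Lemma error_stationary n f : (0 < n)%N ->
  error pi pi p n 0 f ^+ 2 = (n%:R ^+ 2)^-1 *
    \sum_(1 <= k < #|D|) inner pi f (u k) ^+ 2 *
      \sum_(i < n) \sum_(j < n) beta k ^+ natdist i j.
Proof.
move=> n0; rewrite error_sqr //; congr (_ * _).
under [RHS]eq_bigr => k _ do rewrite mulr_sumr.
rewrite [RHS]exchange_big /=; apply: eq_bigr => i _.
under [RHS]eq_bigr => k _ do rewrite mulr_sumr.
rewrite [RHS]exchange_big /=; apply: eq_bigr => j _.
rewrite mean_markov_iter // -(inner_center_markov_iter hD hpi hrev hu).
by apply: eq_bigr.
Qed.

Lemma error_stationary_le n f : (0 < n)%N ->
  error pi pi p n 0 f ^+ 2 <= 2 / (n%:R * (1 - beta 1%N)) * inner pi f f.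
Proof.
move=> n_gt0; rewrite error_stationary //.
have n0 : 0 < n%:R :> R by rewrite ltr0n.
have b1 : beta 1%N < 1.
  by rewrite (le_lt_trans (ler_norm _)) // (spectral_beta_lt1 hD hpi hp herg hu) ?hD.
apply: (@le_trans _ _ ((n%:R ^+ 2)^-1 * (\sum_(1 <= k < #|D|)
    inner pi f (u k) ^+ 2 * (2 * n%:R / (1 - beta 1%N))))).
  rewrite ler_wpM2l ?invr_ge0 ?sqr_ge0 // !big_nat; apply: ler_sum => k hk.
  rewrite ler_wpM2l ?sqr_ge0 // dist_power_sum_le //.
    have := spectral_beta_lt1 hD hpi hp herg hu hk.
    by rewrite ltr_norml => /andP[/ltW].
  exact: (spectral_beta_le1 hu hk).
rewrite -mulr_suml.
have -> : \sum_(1 <= k < #|D|) inner pi f (u k) ^+ 2 = inner pi (center f) (center f).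
  rewrite (spectral_parseval_center hD hpi hu) !big_nat; apply: eq_bigr => k hk.
  by rewrite (inner_center_u hD hu).
have -> : (n%:R ^+ 2)^-1 * (inner pi (center f) (center f) *
    (2 * n%:R / (1 - beta 1%N))) =
    2 / (n%:R * (1 - beta 1%N)) * inner pi (center f) (center f).
  by field; rewrite ?gt_eqF //; lra.
rewrite ler_wpM2l ?inner_center_le //.
by rewrite divr_ge0 // mulr_ge0 // ?ler0n; lra.
Qed.

(** After the change of measure the [pi]-means cancel against the stationary error, leaving pairings
    with the density deviation. The rate c is free because the l_4 estimate decays only like
    sqrt(b)^k. *)
Lemma error_bias_le n n0 f (A c : R) : (0 < n)%N -> 0 <= A -> 0 <= c < 1 ->
  (forall k, inner pi (product k f) (product k f) <= (A * c ^+ k) ^+ 2) ->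
  `|error pi nu p n n0 f ^+ 2 - error pi pi p n 0 f ^+ 2| <=
  2 * A * Num.sqrt (linfnorm dens) * b ^+ n0 / (n%:R ^+ 2 * (1 - b) * (1 - c)).
Proof.
move=> n_gt0 A0 hc hA; have hb := beta_abs_bounds hD hpi hp herg hu.
have /andP[b0 b1] := hb; have /andP[c0 c1] := hc.
rewrite !error_sqr // -mulrBr -sumrB.
under eq_bigr => i _ do rewrite -sumrB.
under eq_bigr => i _ do under eq_bigr => j _ do
  rewrite mean_density !mean_markov_iter // addrAC subrr add0r.
rewrite normrM ger0_norm ?invr_ge0 ?sqr_ge0 //.
set s := Num.sqrt _; have s0 : 0 <= s by exact: sqrtr_ge0.
apply: (@le_trans _ _ ((n%:R ^+ 2)^-1 *
    (A * s * b ^+ n0 * (2 / ((1 - b) * (1 - c)))))); last first.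
  rewrite le_eqVlt; apply/orP; left; apply/eqP.
  by field; rewrite pnatr_eq0 -lt0n n_gt0 !gt_eqF //; lra.
rewrite ler_wpM2l ?invr_ge0 ?sqr_ge0 //.
apply: (@le_trans _ _ (A * s * b ^+ n0 *
    \sum_(i < n) \sum_(j < n) b ^+ minn i j * c ^+ natdist i j)); last first.
  by rewrite ler_wpM2l ?min_dist_power_sum_le // !mulr_ge0 ?exprn_ge0.
apply: le_trans (ler_norm_sum _ _ _) _; rewrite mulr_sumr; apply: ler_sum => i _.
apply: le_trans (ler_norm_sum _ _ _) _; rewrite mulr_sumr; apply: ler_sum => j _.
have Ac0 : 0 <= A * c ^+ natdist i j by rewrite mulr_ge0 ?exprn_ge0.
apply: le_trans (inner_density_le _ Ac0 (hA _)) _.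
by rewrite exprD le_eqVlt; apply/orP; left; apply/eqP; rewrite -/s; ring.
Qed.

Lemma error_le n n0 f (A c : R) : (0 < n)%N -> 0 <= A -> 0 <= c < 1 ->
  (forall k, inner pi (product k f) (product k f) <= (A * c ^+ k) ^+ 2) ->
  error pi nu p n n0 f ^+ 2 <=
  2 / (n%:R * (1 - beta 1%N)) * inner pi f f +
  2 * A * Num.sqrt (linfnorm dens) * b ^+ n0 / (n%:R ^+ 2 * (1 - b) * (1 - c)).
Proof.
move=> n_gt0 A0 hc hA.
have := error_bias_le n0 n_gt0 A0 hc hA; have := error_stationary_le f n_gt0.
by rewrite ler_norml => h1 /andP[_ h2]; lra.
Qed.

(** One factor is bounded pointwise by C, the other contracted in l_2. *)
Lemma product_l2_le_sup k f (C : R) : 0 <= C ->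
  (forall x, `|f x - mean pi f| <= C) ->
  inner pi (product k f) (product k f) <= (C * Num.sqrt (inner pi f f) * b ^+ k) ^+ 2.
Proof.
move=> C0 hC; rewrite !exprMn sqr_sqrtr ?inner_ge0 //.
apply: (@le_trans _ _ (C ^+ 2 * inner pi (P k (center f)) (P k (center f)))).
  rewrite mulr_sumr; apply: ler_sum => x _.
  rewrite [leRHS]mulrA ler_wpM2r ?hpi.1 // mulrACA ler_wpM2r -?expr2 ?sqr_ge0 //.
  by rewrite -real_normK ?num_real // lerXn2r ?nnegrE.
rewrite -mulrA ler_wpM2l ?sqr_ge0 //.
have E x : P k (center f) x = P k f x - mean pi (P k f).
  by rewrite markov_iterB markov_iter_cst // mean_markov_iter.
rewrite [leRHS]mulrC; apply: le_trans (markov_iter_contraction hD hpi hp hrev herg hu k f).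
by rewrite /inner; under eq_bigr => x _ do rewrite E.
Qed.

Lemma markov_iter_l4 k f :
  \sum_x (P k f x - mean pi f) ^+ 4 * pi x <=
  1024 * (b ^+ k) ^+ 2 * \sum_x f x ^+ 4 * pi x.
Proof.
apply: (truncated_l2_le_l4 hpi (y := fun x => P k f x - mean pi f)).
  exact: sqr_ge0.
move=> s s0.
(* On the clipped part, P^k minus the mean is at most 2s pointwise. So (|y| - 2s)_+ is dominated by
   the centered image of [soft], to which the l_2 contraction applies. *)
pose clip x := Num.max (- s) (Num.min s (f x)).
pose soft x := f x - clip x.
have clip_le x : `|clip x| <= s.
  by rewrite ler_norml /clip le_max lexx ge_max ge_min lexx andbT; lra.
have soft_sqr x : soft x ^+ 2 = Num.max 0 (`|f x| - s) ^+ 2 by exact: soft_threshold_sqr.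
under [X in _ <= _ * X]eq_bigr => x _ do rewrite -soft_sqr expr2.
apply: le_trans (markov_iter_contraction hD hpi hp hrev herg hu k soft).
apply: ler_sum => x _; rewrite ler_wpM2r ?hpi.1 // -expr2 mean_markov_iter //.
rewrite -[leRHS]real_normK ?num_real // lerXn2r ?nnegrE ?le_max ?lexx //.
rewrite ge_max normr_ge0 /=.
have -> : mean pi soft = mean pi f - mean pi clip.
  by rewrite /mean -sumrB; apply: eq_bigr => y _; rewrite mulrBl.
rewrite markov_iterB.
have h1 := markov_iter_norm_le hp k x clip_le.
have h2 := mean_norm_le hpi clip_le.
have := ler_normB (P k f x - P k clip x - (mean pi f - mean pi clip))
  (mean pi clip - P k clip x).
have -> : P k f x - P k clip x - (mean pi f - mean pi clip) -
  (mean pi clip - P k clip x) = P k f x - mean pi f by ring.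
by have := ler_normB (mean pi clip) (P k clip x); lra.
Qed.

Lemma product_l2_le_l4 k f :
  inner pi (product k f) (product k f) <=
  (8 * Num.sqrt 2 * lpnorm pi 4 f ^+ 2 * Num.sqrt b ^+ k) ^+ 2.
Proof.
have /andP[b0 b1] := beta_abs_bounds hD hpi hp herg hu.
set N := lpnorm pi 4 f ^+ 2.
have N2 : N ^+ 2 = \sum_x f x ^+ 4 * pi x by exact: lpnorm4_pow4.
have N0 : 0 <= N by exact: sqr_ge0.
have -> : (8 * Num.sqrt 2 * N * Num.sqrt b ^+ k) ^+ 2 = 128 * b ^+ k * N ^+ 2.
  by rewrite !exprMn -(exprM (Num.sqrt b)) mulnC (exprM (Num.sqrt b)) !sqr_sqrtr //; ring.
have E x : P k (center f) x = P k f x - mean pi f.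
  by rewrite markov_iterB markov_iter_cst.
have rhs0 : 0 <= 128 * b ^+ k * N ^+ 2.
  by rewrite mulr_ge0 ?sqr_ge0 // mulr_ge0 ?exprn_ge0.
rewrite -ler_sqr ?nnegrE ?inner_ge0 //.
have -> : inner pi (product k f) (product k f) =
    inner pi (fun x => center f x ^+ 2) (fun x => P k (center f) x ^+ 2).
  by apply: eq_bigr => x _; rewrite -expr2 exprMn.
apply: le_trans (inner_cauchy_schwarz hpi _ _) _.
(* Centering costs 16 and interpolation 1024; 16 * 1024 = 128^2 and 128 = (8 sqrt 2)^2. *)
have -> : (128 * b ^+ k * N ^+ 2) ^+ 2 =
    (16 * N ^+ 2) * (1024 * (b ^+ k) ^+ 2 * N ^+ 2) by ring.
rewrite ler_pM ?inner_ge0 // N2.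
  apply: le_trans (center_pow4_sum hpi f).
  by apply: ler_sum => x _; rewrite -exprD.
apply: le_trans (markov_iter_l4 k f).
by apply: ler_sum => x _; rewrite -exprD E.
Qed.

End ErrorBounds.

(** * The limit of the scaled error *)

Lemma cvg_of_dist_le (R : realType) (v : nat -> R) (l C : R) :
  (forall n, (0 < n)%N -> `|v n - l| <= C / n%:R) -> v @ \oo --> l.
Proof.
move=> vC; apply/cvgrPdist_le => e e0; near=> n.
have n_gt0 : (0 < n)%N by near: n; exact: nbhs_infty_gt.
rewrite distrC; apply: le_trans (vC n n_gt0) _.
rewrite ler_pdivrMr ?ltr0n // mulrC -ler_pdivrMr //.
by near: n; exact: nbhs_infty_ger.
Unshelve. all: by end_near. Qed.

Section Limit.
Variables (R : realType) (D : finType) (pi nu : D -> R) (p : D -> D -> R).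
Variables (beta : nat -> R) (u : nat -> D -> R).
Hypotheses (hD : (2 <= #|D|)%N).
Hypotheses (hpi : distribution pi) (hp : stochastic p) (hnu : distribution nu).
Hypotheses (hrev : reversible pi p) (herg : ergodic p).
Hypothesis (hu : spectral_basis pi p beta u).
Local Notation b := (beta_abs D beta).

(** Bias and stationary remainder are both O(1/n^2), hence O(1/n) after scaling. The sup-norm
    estimate with rate b supplies the constant for the bias. *)
Lemma error_cvg n0 (f : D -> R) :
  (fun n : nat => n%:R * error pi nu p n n0 f ^+ 2) @ \oo -->
  \sum_(1 <= k < #|D|)
    `|inner pi f (u k)| ^+ 2 * ((1 + beta k) / (1 - beta k)).
Proof.
have hb := beta_abs_bounds hD hpi hp herg hu; have /andP[b0 b1] := hb.
pose A := 2 * linfnorm f * Num.sqrt (inner pi f f).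
have A0 : 0 <= A by rewrite !mulr_ge0 ?linfnorm_ge0 ?sqrtr_ge0.
pose C1 := 2 * A * Num.sqrt (linfnorm (fun x => nu x / pi x - 1)) * b ^+ n0 /
  ((1 - b) * (1 - b)).
pose C2 := \sum_(1 <= k < #|D|) inner pi f (u k) ^+ 2 * (4 / (1 - beta k) ^+ 2).
apply: (@cvg_of_dist_le _ _ _ (C1 + C2)) => n n_gt0.
have n_pos : 0 < n%:R :> R by rewrite ltr0n.
have bias : n%:R * `|error pi nu p n n0 f ^+ 2 - error pi pi p n 0 f ^+ 2| <= C1 / n%:R.
  have -> : C1 / n%:R = n%:R * (2 * A *
      Num.sqrt (linfnorm (fun x => nu x / pi x - 1)) * b ^+ n0 /
      (n%:R ^+ 2 * (1 - b) * (1 - b))).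
    by rewrite /C1; field; rewrite !gt_eqF //; lra.
  rewrite ler_wpM2l //.
  apply: (error_bias_le hD hpi hp hnu hrev herg hu) => // k.
  apply: (product_l2_le_sup hD hpi hp hrev herg hu).
    by rewrite mulr_ge0 ?linfnorm_ge0.
  exact: center_linfnorm_le.
have stat : `|n%:R * error pi pi p n 0 f ^+ 2 - \sum_(1 <= k < #|D|)
    `|inner pi f (u k)| ^+ 2 * ((1 + beta k) / (1 - beta k))| <= C2 / n%:R.
  rewrite (error_stationary hD hpi hp hrev hu) //.
  rewrite expr2 invfM mulrA mulVKf ?gt_eqF // mulrC.
  set S := \sum_(_ <= _ < _) _; set s := \sum_(_ <= _ < _) _.
  have -> : S / n%:R - s = (S - n%:R * s) / n%:R by field; rewrite gt_eqF.
  rewrite normrM [X in _ * X]ger0_norm ?invr_ge0 // ler_wpM2r ?invr_ge0 //.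
  rewrite /S /s mulr_sumr -sumrB; apply: le_trans (ler_norm_sum _ _ _) _.
  rewrite /C2 !big_nat; apply: ler_sum => k hk.
  rewrite real_normK ?num_real // [n%:R * _]mulrCA -mulrBr normrM.
  rewrite ger0_norm ?sqr_ge0 // ler_wpM2l ?sqr_ge0 //.
  apply: dist_power_sum_asymptotics.
  exact: (spectral_beta_lt1 hD hpi hp herg hu hk).
rewrite mulrDl; apply: le_trans _ (lerD bias stat).
rewrite -[X in _ <= X * _ + _]ger0_norm // -normrM.
apply: le_trans _ (ler_normD _ _).
by rewrite mulrBr addrA subrK.
Qed.

End Limit.

Theorem theorem11 (R : realType) (D : finType) (pi nu : D -> R)
    (p : D -> D -> R) (beta : nat -> R) (u : nat -> D -> R) (f : D -> R)
    (hD : (2 <= #|D|)%N)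
    (hpi : distribution pi) (hp : stochastic p) (hnu : distribution nu)
    (herg : ergodic p) (hrev : reversible pi p)
    (hu : spectral_basis pi p beta u) :
  let a := fun k : nat => inner pi f (u k) in
  let b := beta_abs D beta in
  let dens := fun x : D => nu x / pi x - 1 in
  let ipi := fun x : D => 1 / pi x in
  let sigma := \sum_(1 <= k < #|D|)
                 `|a k| ^+ 2 * ((1 + beta k) / (1 - beta k)) in
  (forall n0 : nat,
     (fun n : nat => n%:R * error pi nu p n n0 f ^+ 2) @ \oo --> sigma) /\
  ((fun n : nat => n%:R * error pi pi p n 0 f ^+ 2) @ \oo --> sigma) /\
  (forall n n0 : nat, (1 <= n)%N ->
     [/\ error pi nu p n n0 f ^+ 2 <=
           2 / (n%:R * (1 - beta 1%N)) * lpnorm pi 2 f ^+ 2 +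
           2 * Num.sqrt (linfnorm ipi) * Num.sqrt (linfnorm dens) * b ^+ n0
             / (n%:R ^+ 2 * (1 - b) ^+ 2) * lpnorm pi 2 f ^+ 2,
         error pi nu p n n0 f ^+ 2 <=
           2 / (n%:R * (1 - beta 1%N)) * lpnorm pi 4 f ^+ 2 +
           16 * Num.sqrt 2 * Num.sqrt (linfnorm dens) * b ^+ n0
             / (n%:R ^+ 2 * (1 - b) * (1 - Num.sqrt b)) * lpnorm pi 4 f ^+ 2
       & error pi nu p n n0 f ^+ 2 <=
           2 / (n%:R * (1 - beta 1%N)) * linfnorm f ^+ 2 +
           4 * Num.sqrt (linfnorm dens) * b ^+ n0
             / (n%:R ^+ 2 * (1 - b) ^+ 2) * linfnorm f ^+ 2]).
Proof.
have hb := beta_abs_bounds hD hpi hp herg hu.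
move=> a b dens ipi sigma; split; first by move=> n0; exact: error_cvg.
split; first exact: error_cvg.
move=> n n0 n_gt0; have /andP[b0 b1] : 0 <= b < 1 := hb.
have b1' : beta 1%N < 1.
  by rewrite (le_lt_trans (ler_norm _)) // (spectral_beta_lt1 hD hpi hp herg hu) ?hD.
have n_pos : 0 < n%:R :> R by rewrite ltr0n.
have c0 : 0 <= 2 / (n%:R * (1 - beta 1%N)).
  by rewrite divr_ge0 // mulr_ge0 //; lra.
have s0 : 0 <= Num.sqrt (linfnorm dens) by exact: sqrtr_ge0.
have bn0 : 0 <= b ^+ n0 by exact: exprn_ge0.
have f2_0 : 0 <= Num.sqrt (inner pi f f) by exact: sqrtr_ge0.
have sb1 : 0 <= Num.sqrt b < 1.
  by rewrite sqrtr_ge0 /= -[X in _ < X]sqrtr1 ltr_sqrt.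
have bound := error_le hD hpi hp hnu hrev herg hu n0 n_gt0.
split.
- rewrite lpnorm2_sqr //.
  (* A single term of the squared l_2-norm gives pi(x) g(x)^2 <= |g|_2^2 <= |f|_2^2 for the centered
     g. *)
  have sup x : `|f x - mean pi f| <= Num.sqrt (linfnorm ipi) * Num.sqrt (inner pi f f).
    rewrite -ler_sqr ?nnegrE ?mulr_ge0 ?sqrtr_ge0 //.
    rewrite real_normK ?num_real // exprMn !sqr_sqrtr ?linfnorm_ge0 ?inner_ge0 //.
    have pix := stationary_gt0 hpi hrev herg x.
    apply: (@le_trans _ _ (ipi x * inner pi f f)); last first.
      rewrite ler_wpM2r ?inner_ge0 //; apply: le_trans (ler_norm _) _.
      exact: le_linfnorm.
    rewrite /ipi mul1r -ler_pdivrMl ?invr_gt0 // invrK.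
    apply: le_trans (inner_center_le hpi f); rewrite [leRHS](bigD1 x) //=.
    rewrite -expr2 mulrC lerDl; apply: sumr_ge0 => y _.
    by rewrite -expr2 mulr_ge0 ?sqr_ge0 ?hpi.1.
  have C0 : 0 <= Num.sqrt (linfnorm ipi) * Num.sqrt (inner pi f f).
    by rewrite mulr_ge0 ?sqrtr_ge0.
  apply: le_trans (bound f _ b _ hb (fun k =>
    product_l2_le_sup hD hpi hp hrev herg hu k C0 sup)) _; first by rewrite mulr_ge0.
  rewrite lerD2l le_eqVlt; apply/orP; left; apply/eqP.
  rewrite -[in RHS](sqr_sqrtr (inner_ge0 hpi f)) -/b -/dens.
  by field; rewrite !gt_eqF //; lra.
(* Here c = sqrt b and A = 8 sqrt 2 |f|_4^2, so 2A yields 16 sqrt 2. *)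
- apply: le_trans (bound f _ _ _ sb1 (product_l2_le_l4 hD hpi hp hrev herg hu ^~ f)) _.
    by rewrite mulr_ge0 ?sqr_ge0 // mulr_ge0 ?sqrtr_ge0.
  apply: lerD; first by rewrite ler_wpM2l ?inner_le_lpnorm4.
  rewrite le_eqVlt; apply/orP; left; apply/eqP; rewrite -/b -/dens.
  by move/andP: sb1 => [_ sb1]; field; rewrite !gt_eqF //; lra.
(* Centering doubles the sup norm, so 2A = 4 |f|_oo |f|_2, and |f|_2 <= |f|_oo finishes. *)
- have C0 : 0 <= 2 * linfnorm f by rewrite mulr_ge0 ?linfnorm_ge0.
  apply: le_trans (bound f _ b _ hb (fun k =>
    product_l2_le_sup hD hpi hp hrev herg hu k C0 (center_linfnorm_le hpi f))) _.
    by rewrite mulr_ge0.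
  apply: lerD; first by rewrite ler_wpM2l ?inner_le_linfnorm.
  have fle : Num.sqrt (inner pi f f) <= linfnorm f.
    rewrite -ler_sqr ?nnegrE ?linfnorm_ge0 // sqr_sqrtr ?inner_ge0 //.
    exact: inner_le_linfnorm.
  rewrite -/b -/dens.
  set K := 4 * Num.sqrt (linfnorm dens) * b ^+ n0 / (n%:R ^+ 2 * (1 - b) ^+ 2).
  have K0 : 0 <= K.
    rewrite divr_ge0 ?mulr_ge0 ?sqr_ge0 //; lra.
  apply: (@le_trans _ _ (K * (linfnorm f * Num.sqrt (inner pi f f)))).
    rewrite le_eqVlt; apply/orP; left; apply/eqP; rewrite /K.
    by field; rewrite !gt_eqF //; lra.
  by rewrite ler_wpM2l // expr2 ler_wpM2l ?linfnorm_ge0.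
Qed.
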